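(* Let $A:[0,1]\to\mathbb{R}$, $A(x)=\sin^2(2\pi x)$, and let $T(x)=2x \pmod 1$ act on the circle $S^1=[0,1]/\{0\sim 1\}$, with inverse branches $\tau_1(x)=x/2$ and $\tau_2(x)=(x+1)/2$. Put $\hat m(A)=\frac{A(1/3)+A(2/3)}{2}$, $\eta(x)=\frac{x}{4}+\frac12$, $F(x)=A\left(\frac{x}{2}\right)+A\left(\frac{x}{4}+\frac12\right)$, and for $x\in[0,1]$ $$V_2(x)=\lim_{n\to\infty}\sum_{i=0}^{n-1}\bigl[F(\eta^i(x))-2\hat m(A)\bigr],$$ where $\eta^i$ is the $i$-th iterate of $\eta$ ($\eta^0=\mathrm{id}$). Define $V_1(x)=V_2\left(\frac{x+1}{2}\right)+A\left(\frac{x+1}{2}\right)-\hat m(A)$ and $$V(x)=V_1(x)\,I_{[0,1/2)}(x)+V_2(x)\,I_{[1/2,1]}(x).$$ Then $V$ is a calibrated subaction for $A$, with $\hat m(A)=\frac{A(1/3)+A(2/3)}{2}=m(A)$; that is, for every $x\in[0,1]$, $$V(x)=\max\Bigl\{A\left(\tfrac{x}{2}\right)+V\left(\tfrac{x}{2}\right),\,A\left(\tfrac{x+1}{2}\right)+V\left(\tfrac{x+1}{2}\right)\Bigr\}-m(A).$$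
   Context: $I_E$ denotes the indicator function of $E$. For continuous $A$, $m(A)=\sup\{\int A\,d\rho : \rho \text{ a } T\text{-invariant Borel probability}\}$. A calibrated subaction for $A$ is a continuous function $V:S^1\to\mathbb{R}$ such that $V(x)=\max_{T(y)=x}[A(y)+V(y)-m(A)]$ for all $x$. *)

(* Defs.v *)
From mathcomp Require Import all_boot all_order all_algebra.
From mathcomp Require Import all_classical all_reals all_analysis.
Set Implicit Arguments. Unset Strict Implicit. Unset Printing Implicit Defensive.
Import Order.TTheory GRing.Theory Num.Theory numFieldNormedType.Exports.
Local Open Scope classical_set_scope.
Local Open Scope ring_scope.

Section Defs.
Variable R : realType.

(* The circle S^1 = [0,1]/(0~1) is represented by R, functions being read
   modulo 1; the doubling map T(x) = 2x mod 1 takes values in [0,1). *)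
Definition Tdbl (x : R) : R := 2 * x - (Num.floor (2 * x))%:~R.

Definition Asin (x : R) : R := sin (2 * pi * x) ^+ 2.

(* T-invariant Borel probability measures on S^1: Borel probabilities on R
   carried by [0,1) and invariant under T. *)
Definition T_invariant (mu : probability R R) : Prop :=
  mu `[0%R, 1%R[%classic = 1%E /\
  forall B : set R, measurable B -> mu (Tdbl @^-1` B) = mu B.

Definition mA (A : R -> R) : \bar R :=
  ereal_sup [set y | exists mu : probability R R,
                       T_invariant mu /\ y = (\int[mu]_x (A x)%:E)%E].

(* calibrated subaction: V continuous on S^1 and
   V(x) = max_{T y = x} [A y + V y - m(A)], the preimages of x being
   tau_1 x = x/2 and tau_2 x = (x+1)/2. *)
Definition calibrated_subaction (A V : R -> R) : Prop :=
  [/\ {within `[0%R, 1%R]%classic, continuous V}, V 0 = V 1 &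
      forall x : R, x \in `[0, 1] ->
        V x = Num.max (A (x / 2) + V (x / 2))
                      (A ((x + 1) / 2) + V ((x + 1) / 2)) - fine (mA A)].

Definition mhat : R := (Asin (1 / 3) + Asin (2 / 3)) / 2.
Definition eta (x : R) : R := x / 4 + 1 / 2.
Definition Ffun (x : R) : R := Asin (x / 2) + Asin (x / 4 + 1 / 2).

Definition V2 (x : R) : R :=
  lim ((fun n : nat => \sum_(0 <= i < n) (Ffun (iter i eta x) - 2 * mhat)) @ \oo).

Definition V1 (x : R) : R := V2 ((x + 1) / 2) + Asin ((x + 1) / 2) - mhat.

Definition Vfun (x : R) : R :=
  V1 x * (if x \in `[0, 1 / 2[ then 1 else 0) +
  V2 x * (if x \in `[1 / 2, 1] then 1 else 0).

End Defs.

(* Main.v *)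
(** With [f x = sin (pi x)^2 - 3/4] and the contraction [tau x = 1 - x/2], which
    satisfies [tau \o tau = eta], one has [V2 x = \sum_k f (tau^k x)], hence
    [V2 x = f x + V2 (tau x)].  Since [f (1 - x) = f x], this gives
    [V1 x = V2 (1 - x)], so the calibration equation reduces to
    [V2 (1 - x) <= V2 x] for [x] in [[1/2, 1]], that is to
    [V2 (3/4 + h) <= V2 (3/4 - h)] for [h] in [[0, 1/4]].  The latter holds term
    by term: [Ffun (c + h) <= Ffun (c - h)] for every [c] in [[2/3, 3/4]].

    The value of [m(A)] is obtained independently of [V]: the upper bound comes
    from a trigonometric coboundary, and the orbit measure on [{1/3, 2/3}]
    attains it. *)
From HB Require Import structures.
Require Import Defs.
From mathcomp Require Import all_boot all_order all_algebra.
From mathcomp Require Import all_classical all_reals all_analysis.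
From mathcomp Require Import ring lra measurable_realfun.
Import Order.TTheory GRing.Theory Num.Theory numFieldNormedType.Exports.
Local Open Scope classical_set_scope.
Local Open Scope ring_scope.

(** * Special cosine values and the Lipschitz bound for the squared sine *)

Section Trigonometry.
Context {R : realType}.
Implicit Types (a x y c h t : R).

Lemma cos_le0pi x y : 0 <= x -> x <= y -> y <= pi -> cos y <= cos x.
Proof.
move=> x0 xy ypi; rewrite leNgt ltr_cos ?in_itv /= -?leNgt //; lra.
Qed.

Lemma cos_pi3 : cos (pi / 3 : R) = 1 / 2.
Proof.
have pi0 := pi_gt0 R.
have c0 : 0 < cos (pi / 3 : R) by apply: cos_gt0_pihalf; lra.
(* With the double-angle formula this gives [2 c^2 + c - 1 = 0], whose only positive root is
   [1 / 2]. *)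
have : cos (pi / 3 *+ 2 : R) = - cos (pi / 3).
  have -> : pi / 3 *+ 2 = - (pi / 3) + pi :> R by rewrite mulr2n; lra.
  by rewrite cosDpi cosN.
rewrite cos_mulr2n => H; nra.
Qed.

Lemma cos_2pi3 : cos (2 * pi / 3 : R) = - (1 / 2).
Proof.
have -> : 2 * pi / 3 = - (pi / 3) + pi :> R by lra.
by rewrite cosDpi cosN cos_pi3.
Qed.

Lemma ler_abs_sin t : `|sin t| <= `|t|.
Proof.
wlog t0 : t / 0 <= t => [H|].
  have [/H//|/ltW t0] := leP 0 t.
  by rewrite -normrN -sinN -[leRHS]normrN H // oppr_ge0.
have [|c _] := @MVT_segment R sin cos 0 t t0 (fun x _ => is_derive_sin x).
  by apply: continuous_subspaceT => x; exact: continuous_sin.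
rewrite sin0 !subr0 => ->; rewrite normrM ler_piMl //.
exact: cos_max.
Qed.

Lemma sin2B x y : sin x ^+ 2 - sin y ^+ 2 = sin (x + y) * sin (x - y).
Proof.
rewrite sinD sinB.
have -> : (sin x * cos y + cos x * sin y) * (sin x * cos y - cos x * sin y) =
  sin x ^+ 2 * cos y ^+ 2 - cos x ^+ 2 * sin y ^+ 2 by ring.
by rewrite !cos2sin2; ring.
Qed.

Lemma sin2_lipschitz x y : `|sin x ^+ 2 - sin y ^+ 2| <= `|x - y|.
Proof.
by rewrite sin2B normrM (le_trans _ (ler_abs_sin _)) // ler_piMl // sin_max.
Qed.

End Trigonometry.

(** * The centred potential and the reflection inequality for [Ffun] *)

Section Potential.
Context {R : realType}.
Implicit Types (a x y c h t : R).

(** The common value of [Asin - 3 / 4] at the two preimages of [x]: [Asin] has period [1 / 2], so it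
    does not distinguish them. *)
Definition sin2pi_ctr x : R := sin (pi * x) ^+ 2 - 3 / 4.
Local Notation f := sin2pi_ctr.

(** The second inverse branch applied to [1 - x]; its fixed point [2 / 3] is also that of [eta]. *)
Definition tau x : R := 1 - x / 2.

Lemma Asin_third : Asin (1 / 3 : R) = 3 / 4.
Proof.
rewrite /Asin sin2cos2 (_ : 2 * pi * (1 / 3) = 2 * pi / 3); last by lra.
by rewrite cos_2pi3; lra.
Qed.

Lemma Asin_two_thirds : Asin (2 / 3 : R) = 3 / 4.
Proof.
rewrite /Asin sin2cos2 (_ : 2 * pi * (2 / 3) = (2 * pi / 3) *+ 2);
  last by rewrite mulr2n; lra.
by rewrite cos_mulr2n cos_2pi3 mulr2n; lra.
Qed.

Lemma mhatE : mhat R = 3 / 4.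
Proof. by rewrite /mhat Asin_third Asin_two_thirds; lra. Qed.

Lemma sin2pi_ctr_refl x : f (1 - x) = f x.
Proof.
rewrite /f (_ : pi * (1 - x) = - (pi * x) + pi); last by ring.
by rewrite sinDpi sinN opprK.
Qed.

Lemma Asin_branch1 x : Asin (x / 2) = f x + 3 / 4.
Proof. by rewrite /Asin /f (_ : 2 * pi * (x / 2) = pi * x); lra. Qed.

Lemma Asin_branch2 x : Asin ((x + 1) / 2) = f x + 3 / 4.
Proof.
rewrite /Asin /f (_ : 2 * pi * ((x + 1) / 2) = pi * x + pi); last by lra.
by rewrite sinDpi sqrrN; lra.
Qed.

Lemma FfunE x : Ffun x - 2 * mhat R = f x + f (tau x).
Proof.
rewrite /Ffun mhatE (_ : x / 4 + 1 / 2 = (x / 2 + 1) / 2); last by lra.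
rewrite Asin_branch1 Asin_branch2 /tau sin2pi_ctr_refl; lra.
Qed.

Lemma tau_tau x : tau (tau x) = eta x.
Proof. by rewrite /tau /eta; lra. Qed.

Lemma iter_eta n x : iter n (@eta R) x = 2 / 3 + (x - 2 / 3) / 4 ^+ n.
Proof.
elim: n => [|n /= ->]; first by rewrite expr0 divr1 /=; ring.
rewrite /eta exprS; field.
by rewrite expf_neq0 // pnatr_eq0.
Qed.

Lemma iter_eta_tau n x : iter n (@eta R) (tau x) = tau (iter n (@eta R) x).
Proof. by rewrite !iter_eta /tau; field; rewrite expf_neq0 // pnatr_eq0. Qed.

Lemma sin2pi_ctr_lipschitz x y : `|f x - f y| <= pi * `|x - y|.
Proof.
rewrite /f opprB addrA subrK (le_trans (sin2_lipschitz _ _)) //.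
by rewrite -mulrBr normrM gtr0_norm // pi_gt0.
Qed.

Lemma Ffun_lipschitz x y : `|Ffun x - Ffun y| <= 2 * pi * `|x - y|.
Proof.
have -> : Ffun x - Ffun y = (f x - f y) + (f (tau x) - f (tau y)).
  by have := FfunE x; have := FfunE y; lra.
rewrite (le_trans (ler_normD _ _)) //.
have := sin2pi_ctr_lipschitz x y; have := sin2pi_ctr_lipschitz (tau x) (tau y).
rewrite (_ : tau x - tau y = - ((x - y) / 2)); last by rewrite /tau; ring.
rewrite normrN normrM (ger0_norm (_ : 0 <= 2^-1)); last by lra.
have : 0 <= pi * `|x - y| by rewrite mulr_ge0 // pi_ge0.
rewrite mulrA; lra.
Qed.

Lemma Ffun_fix : Ffun (2 / 3) = 2 * mhat R.
Proof.
rewrite /Ffun mhatE (_ : 2 / 3 / 4 + 1 / 2 = 2 / 3); last by lra.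
by rewrite (_ : 2 / 3 / 2 = 1 / 3) ?Asin_third ?Asin_two_thirds; lra.
Qed.

(** The difference of the two sides factors as [sin (pi h) sin (pi c) (- 4 cos (pi c) cos (pi h) -
    1)]. The last factor is nonnegative because [cos (pi c) <= - 1/2] and [cos (pi h) >= 1/2]. *)
Lemma Ffun_reflect c h : 2 / 3 <= c <= 3 / 4 -> 0 <= h <= 1 / 4 ->
  Ffun (c + h) <= Ffun (c - h).
Proof.
move=> /andP[c1 c2] /andP[h1 h2].
have pi0 := pi_gt0 R.
have FE x : Ffun x = sin (pi * x) ^+ 2 + sin (pi * (x / 2)) ^+ 2.
  have := FfunE x; rewrite mhatE /tau sin2pi_ctr_refl /f; lra.
rewrite -subr_ge0 !FE.
rewrite (_ : forall a b c d : R, a + b - (c + d) = (a - c) + (b - d));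
  last by move=> *; ring.
rewrite !sin2B.
rewrite (_ : pi * (c - h) + pi * (c + h) = (pi * c) *+ 2);
  last by rewrite mulr2n; lra.
rewrite (_ : pi * (c - h) - pi * (c + h) = - ((pi * h) *+ 2));
  last by rewrite mulr2n; lra.
rewrite (_ : pi * ((c - h) / 2) + pi * ((c + h) / 2) = pi * c); last by lra.
rewrite (_ : pi * ((c - h) / 2) - pi * ((c + h) / 2) = - (pi * h)); last by lra.
rewrite !sinN !sin_mulr2n.
have sh : 0 <= sin (pi * h) by apply: sin_ge0_pi; nra.
have sc : 0 <= sin (pi * c) by apply: sin_ge0_pi; nra.
have ch : 1 / 2 <= cos (pi * h) by rewrite -cos_pi3 cos_le0pi//; nra.
have cc : cos (pi * c) <= - (1 / 2) by rewrite -cos_2pi3 cos_le0pi//; nra.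
rewrite [X in 0 <= X](_ : _ = sin (pi * h) * sin (pi * c) *
  (- (4 * cos (pi * c) * cos (pi * h)) - 1)); last by rewrite !mulr2n; ring.
rewrite !mulr_ge0 //; nra.
Qed.

End Potential.

(** * Convergence and symmetry of [V2], and the calibration equation *)

Section Subaction.
Context {R : realType}.
Implicit Types (x y c h : R).
Local Notation f := (@sin2pi_ctr R).
Local Notation term x := (fun i : nat => Ffun (iter i (@eta R) x) - 2 * mhat R).

Lemma V2_term_lipschitz x y i :
  `|Ffun (iter i (@eta R) x) - Ffun (iter i (@eta R) y)| <=
  geometric (2 * pi * `|x - y|) (1 / 4) i.
Proof.
rewrite (le_trans (Ffun_lipschitz _ _)) // !iter_eta /=.
rewrite (_ : _ - (2 / 3 + _) = (x - y) / 4 ^+ i); last first.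
  by field; rewrite expf_neq0 // pnatr_eq0.
by rewrite normrM normfV normrX (@ger0_norm _ 4) // expr_div_n expr1n mulrA
  div1r.
Qed.

Lemma V2_cvg x : cvgn (series (term x)).
Proof.
apply: normed_cvg.
apply: (@series_le_cvg _ _ (geometric (2 * pi * `|x - 2 / 3|) (1 / 4))) =>
  [n|n|n|] /=.
- exact: normr_ge0.
- by rewrite !mulr_ge0 // ?pi_ge0 // exprn_ge0 // divr_ge0.
(* Every term vanishes at the fixed point [2 / 3], so comparison with that point bounds the term
   itself. *)
- apply: le_trans (V2_term_lipschitz x (2 / 3) n).
  by rewrite (iter_eta n (2 / 3)) subrr mul0r addr0 Ffun_fix.
- by apply: is_cvg_geometric_series; rewrite ger0_norm; lra.
Qed.

Lemma V2_lipschitz x y : `|V2 x - V2 y| <= 8 / 3 * pi * `|x - y|.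
Proof.
have cx := V2_cvg x; have cy := V2_cvg y.
have cxy : (fun n => `|series (term x) n - series (term y) n|) @ \oo -->
    `|V2 x - V2 y|.
  by apply: cvg_norm; apply: cvgB.
rewrite -(cvg_lim _ cxy) //; apply: limr_le;
  first by apply/cvg_ex; eexists; exact: cxy.
near=> n.
(* The constant is the sum of the geometric series of ratio [1 / 4] that dominates the differences
   of terms. *)
have -> : 8 / 3 * pi * `|x - y| = 2 * pi * `|x - y| * (1 - 1 / 4)^-1 by field.
have g0 : 0 <= 2 * pi * `|x - y| by rewrite !mulr_ge0 // pi_ge0.
have lt14 : 0 < 1 / 4 :> R by lra.
have lt1 : `|1 / 4 : R| < 1 by rewrite gtr0_norm; lra.
apply: le_trans (geometric_le_lim n g0 lt14 lt1).
rewrite /series /= -sumrB (le_trans (ler_norm_sum _ _ _)) // ler_sum // => i _.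
by rewrite opprB addrA subrK V2_term_lipschitz.
Unshelve. all: by end_near.
Qed.

Lemma continuous_V2 : continuous (@V2 R).
Proof.
move=> x; apply/cvgrPdist_le => e e0.
have K0 : 0 < 8 / 3 * pi :> R by have := pi_gt0 R; lra.
near=> y; rewrite (le_trans (V2_lipschitz _ _)) // mulrC -ler_pdivlMr //.
near: y; apply: cvgr_dist_le => //; exact: divr_gt0.
Unshelve. all: by end_near.
Qed.

(* Partial sums of [V2] run over pairs of consecutive iterates of [tau], so
   shifting by one [tau] changes them by a boundary term. *)
Lemma series_V2_tau n x :
  series (term (tau x)) n + f x = series (term x) n + f (iter n (@eta R) x).
Proof.
elim: n => [|n IH]; first by rewrite /series /= !big_geq.
rewrite !seriesEnat /= in IH *; rewrite !big_nat_recr //= !FfunE.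
rewrite iter_eta_tau tau_tau in IH *; lra.
Qed.

Lemma V2_tau x : V2 x = f x + V2 (tau x).
Proof.
(* The boundary term dies out: the iterates of [eta] tend to [2 / 3], a zero of [f]. *)
have fit : (fun n => f (iter n (@eta R) x)) @ \oo --> (0 : R).
  have cg : (fun n => geometric (pi * `|x - 2 / 3|) (1 / 4) n) @ \oo -->
      (0 : R).
    by apply: cvg_geometric; rewrite ger0_norm; lra.
  apply: norm_cvg0; apply: (@squeeze_cvgr _ _ _ _ (cst 0) _ _ _ _ _ cg);
    last exact: cvg_cst.
  apply: nearW => n /=; rewrite normr_ge0 /=.
  have f0 : f (2 / 3) = 0.
    by have := @Asin_branch1 R (2 / 3);
      rewrite (_ : 2 / 3 / 2 = 1 / 3) ?Asin_third; lra.
  rewrite -[f _]subr0 -f0 (le_trans (sin2pi_ctr_lipschitz _ _)) // iter_eta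
    addrAC subrr add0r.
  by rewrite normrM normfV normrX (@ger0_norm _ 4) // expr_div_n expr1n mulrA
    div1r.
have cL : (fun n => series (term (tau x)) n + f x) @ \oo --> V2 (tau x) + f x.
  by apply: cvgD; [exact: V2_cvg|exact: cvg_cst].
have cR : (fun n => series (term x) n + f (iter n (@eta R) x)) @ \oo -->
    V2 x + 0.
  by apply: cvgD => //; exact: V2_cvg.
move: cL; rewrite (funext (fun n => series_V2_tau n x)) => cL.
have E : V2 (tau x) + f x = V2 x + 0.
  exact: (cvg_unique (@Rhausdorff R) cL cR).
lra.
Qed.

Lemma V1E x : V1 x = V2 (1 - x).
Proof.
rewrite V2_tau sin2pi_ctr_refl /V1 Asin_branch2 mhatE.
by rewrite (_ : tau (1 - x) = (x + 1) / 2) /tau; lra.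
Qed.

Lemma V2_reflect34 h : 0 <= h <= 1 / 4 -> V2 (3 / 4 + h) <= V2 (3 / 4 - h).
Proof.
move=> /andP[h0 h1]; apply: ler_lim; [exact: V2_cvg|exact: V2_cvg|].
near=> n; apply: ler_sum => i _; rewrite lerB // !iter_eta.
have p1 : 1 <= 4 ^+ i :> R by rewrite exprn_ege1 // ler1n.
have p0 : 0 < 4 ^+ i :> R by lra.
set q : R := (4 ^+ i)^-1.
have q0 : 0 < q by rewrite invr_gt0.
have q1 : q <= 1 by rewrite invf_le1.
(* The affine iterates of [3 / 4 + h] and [3 / 4 - h] stay symmetric about the iterate
   [2 / 3 + q / 12] of [3 / 4], which lies in [[2/3, 3/4]] as [0 < q <= 1]. *)
rewrite (_ : _ + (3 / 4 + h - _) * q = (2 / 3 + q / 12) + h * q); last by field.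
rewrite (_ : _ + (3 / 4 - h - _) * q = (2 / 3 + q / 12) - h * q); last by field.
apply: Ffun_reflect; apply/andP; split; nra.
Unshelve. all: by end_near.
Qed.

(** One use of [V2_tau] on each side cancels [f x] and moves the two points to [3 / 4 + h] and
    [3 / 4 - h] with [h = (x - 1/2) / 2]. *)
Lemma V2_reflect x : 1 / 2 <= x <= 1 -> V2 (1 - x) <= V2 x.
Proof.
move=> /andP[x0 x1]; rewrite V2_tau [leRHS]V2_tau sin2pi_ctr_refl lerD2l.
have := @V2_reflect34 ((x - 1 / 2) / 2).
rewrite (_ : tau (1 - x) = 3 / 4 + (x - 1 / 2) / 2); last by rewrite /tau; lra.
rewrite (_ : tau x = 3 / 4 - (x - 1 / 2) / 2); last by rewrite /tau; lra.
by apply; lra.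
Qed.

(** Folding the interval at [1 / 2] removes the case split, so continuity at [1 / 2] and equality at
    the endpoints become visible. *)
Lemma VfunE x : 0 <= x <= 1 -> Vfun x = V2 (Num.max x (1 - x)).
Proof.
move=> /andP[x0 x1]; rewrite /Vfun !in_itv /= x0 x1 andbT /=.
case: (ltP x (1 / 2)) => x2.
- rewrite V1E mulr1 mulr0 addr0; rewrite max_r; lra.
- rewrite mulr1 mulr0 add0r; rewrite max_l; lra.
Qed.

Lemma VfunE_max x : 0 <= x <= 1 -> Vfun x = Num.max (V2 x) (V2 (1 - x)).
Proof.
move=> x01; rewrite VfunE //; case: (leP x (1 - x)) => x2.
  by rewrite max_r //; have := @V2_reflect (1 - x); rewrite subKr; apply; lra.
by rewrite max_l //; apply: V2_reflect; lra.
Qed.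

Lemma Vfun_calibrated x : 0 <= x <= 1 ->
  Vfun x = Num.max (Asin (x / 2) + Vfun (x / 2))
                   (Asin ((x + 1) / 2) + Vfun ((x + 1) / 2)) - 3 / 4.
Proof.
move=> x01; rewrite VfunE_max // (VfunE (x / 2)); last by lra.
rewrite VfunE; last by lra.
(* The fold sends the two preimages of [x] to [tau x] and [tau (1 - x)], so by [V2_tau] the two arms
   are [V2 x] and [V2 (1 - x)], up to [3 / 4]. *)
rewrite (max_r (_ : x / 2 <= 1 - x / 2)); last by lra.
rewrite (max_l (_ : 1 - (x + 1) / 2 <= (x + 1) / 2)); last by lra.
rewrite Asin_branch1 Asin_branch2 addr_maxl V2_tau [V2 (1 - x)]V2_tau
  sin2pi_ctr_refl.
rewrite (_ : tau (1 - x) = (x + 1) / 2); last by rewrite /tau; lra.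
by congr Num.max; rewrite /tau; lra.
Qed.

Lemma Vfun_continuous : {within `[0%R, 1%R], continuous (@Vfun R)}.
Proof.
apply: (@subspace_eq_continuous _ _ _ (fun x => V2 (Num.max x (1 - x)))).
  by move=> x /set_mem /=; rewrite in_itv /= => x01; exact/esym/VfunE.
apply: continuous_subspaceT => x.
apply: (@continuous_comp _ _ _ (fun x => Num.max x (1 - x)) (@V2 R));
  last exact: continuous_V2.
apply: continuous_max; first exact: cvg_id.
by apply: cvgB; [exact: cvg_cst|exact: cvg_id].
Qed.

End Subaction.

(** * The maximal mean of [Asin] over invariant probabilities *)

Section MaximalMean.
Context {R : realType}.

Lemma Tdbl_third : Tdbl (1 / 3 : R) = 2 / 3.
Proof.
rewrite /Tdbl (@floor_def _ _ 0); first by rewrite subr0; lra.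
by rewrite mulr0z add0r; lra.
Qed.

Lemma Tdbl_two_thirds : Tdbl (2 / 3 : R) = 1 / 3.
Proof.
rewrite /Tdbl (@floor_def _ _ 1); first by rewrite mulr1z; lra.
by rewrite -[1 + 1]/2 mulr1z; lra.
Qed.

Lemma measurable_Tdbl : measurable_fun setT (@Tdbl R).
Proof.
apply: measurable_funB; first exact: measurable_funM.
apply: (measurableT_comp (f := fun x : R => (Num.floor x)%:~R : R)) => //.
  apply: nondecreasing_measurable => // x y xy; rewrite ler_int;
    exact: le_floor.
Qed.

Lemma cos2pi_Tdbl (x : R) : cos (2 * pi * Tdbl x) = 2 * cos (2 * pi * x) ^+ 2 -
  1.
Proof.
have per k a : cos (a - 2 * pi * k%:~R) = cos a :> R.
  have -> : 2 * pi * k%:~R = (pi *+ 2) *~ k :> R by rewrite -mulrzr mulr2n;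
    ring.
  case: k => n;
    first by rewrite -[in RHS](subrK ((pi *+ 2) *+ n) a) (periodicn (@cosD2pi R)).
  by rewrite NegzE mulrNz opprK (periodicn (@cosD2pi R)).
rewrite /Tdbl mulrBr per (_ : 2 * pi * (2 * x) = (2 * pi * x) *+ 2);
  last by rewrite mulr2n; ring.
by rewrite cos_mulr2n mulr2n; ring.
Qed.

Lemma continuous_cos2pi : continuous (fun x : R => cos (2 * pi * x)).
Proof.
move=> x; apply: (@continuous_comp _ _ _ (fun x => 2 * pi * x) (@cos R)).
  exact: mulrl_continuous.
exact: continuous_cos.
Qed.

Lemma measurable_cos2pi : measurable_fun setT (fun x : R => cos (2 * pi * x)).
Proof. exact: continuous_measurable_fun continuous_cos2pi. Qed.

Lemma AsinE (x : R) : Asin x = 1 - cos (2 * pi * x) ^+ 2.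
Proof. by rewrite /Asin sin2cos2. Qed.

Lemma measurable_Asin : measurable_fun setT (@Asin R).
Proof.
rewrite (funext AsinE); apply: measurable_funB => //.
apply: measurable_funX; exact: measurable_cos2pi.
Qed.

Lemma Asin_ge0 (x : R) : 0 <= Asin x. Proof. exact: sqr_ge0. Qed.

(* With [C x = cos (2 pi x)], invariance gives [\int (1 + C) = \int 2 C^2], so
   integrating [(C + 1/2)^2 >= 0] yields [\int C^2 >= 1/4]. *)
Lemma integral_Asin_le (mu : probability R R) : T_invariant mu ->
  (\int[mu]_x (Asin x)%:E <= (3 / 4)%:E)%E.
Proof.
move=> [_ inv].
pose C (x : R) : R := cos (2 * pi * x).
have mC : measurable_fun setT C := measurable_cos2pi.
have mC2 : measurable_fun setT (fun x => C x ^+ 2) by exact: measurable_funX.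
have C2_ge0 x : (0 <= (C x ^+ 2)%:E)%E by rewrite lee_fin sqr_ge0.
set I := (\int[mu]_x (C x ^+ 2)%:E)%E.
have I1 : (\int[mu]_x (Asin x)%:E + I = 1)%E.
  rewrite -ge0_integralD //.
  - under eq_integral do rewrite -EFinD AsinE -/(C _) subrK.
    by rewrite integral_cst // mul1e; exact: probability_setT.
  - by move=> x _; rewrite lee_fin Asin_ge0.
  - by apply/measurable_EFinP; exact: measurable_Asin.
  - by apply/measurable_EFinP.
(* Taking [1 + C] instead of [C] keeps the integrand nonnegative, as the [ge0_] integral lemmas
   require. *)
have I2 : (\int[mu]_x (1 + C x)%:E = I + I)%E.
  have mT := measurable_Tdbl.
  have -> : (\int[mu]_x (1 + C x)%:E =
             \int[pushforward mu (@Tdbl R)]_x (1 + C x)%:E)%E.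
    by apply: eq_measure_integral => B mB _; exact/esym/inv.
  rewrite (ge0_integral_pushforward mT) //; first last.
  - by move=> x _; rewrite lee_fin -lerBlDl sub0r cos_geN1.
  - by apply/measurable_EFinP; exact: measurable_funD.
  rewrite preimage_setT -ge0_integralD //; try exact/measurable_EFinP.
  apply: eq_integral => x _; rewrite /= -EFinD /C cos2pi_Tdbl; congr EFin; ring.
have I3 : (\int[mu]_x ((C x + 1 / 2) ^+ 2)%:E + (3 / 4)%:E =
           I + \int[mu]_x (1 + C x)%:E)%E.
  have mD : measurable_fun setT (fun x => 1 + C x) by exact: measurable_funD.
  have mS : measurable_fun setT (fun x => (C x + 1 / 2) ^+ 2).
    by apply: measurable_funX; exact: measurable_funD.
  have <- : (\int[mu]_x (cst (3 / 4)%:E x) = (3 / 4)%:E)%E.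
    by rewrite integral_cst // [X in (_ * X)%E](probability_setT mu) mule1.
  rewrite -!ge0_integralD //; try exact/measurable_EFinP.
  - by apply: eq_integral => x _; rewrite /= -!EFinD; congr EFin; lra.
  - by move=> x _; rewrite lee_fin -lerBlDl sub0r cos_geN1.
  - by move=> x _; rewrite lee_fin sqr_ge0.
  - by move=> x _; rewrite lee_fin; lra.
have A0 : (0 <= \int[mu]_x (Asin x)%:E)%E.
  by apply: integral_ge0 => x _; rewrite lee_fin Asin_ge0.
have I0 : (0 <= I)%E by exact: integral_ge0.
have : (0 <= \int[mu]_x ((C x + 1 / 2) ^+ 2)%:E)%E.
  by apply: integral_ge0 => x _; rewrite lee_fin sqr_ge0.
move: I3; rewrite {}I2; clearbody I.
(* Nonnegative integrals with sum 1 are finite, so what remains is real arithmetic: [b + 3/4 = 3 i]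
   with [b >= 0] gives [i >= 1/4], and [a = 1 - i]. *)
move: A0 I0 I1; case: (integral _ _ _) => [a| |] //; case: I => [i| |] //.
case: (integral _ _ _) => [b| |] //.
rewrite -!EFinD !lee_fin => a0 i0 [ai] [bi] b0; lra.
Qed.

(** Indexing the period-two orbit by [bool] makes its orbit measure the law of a function of a fair
    coin, so integrals reduce to Bernoulli ones. *)
Definition half_orbit (b : bool) : R := if b then 1 / 3 else 2 / 3.

Lemma measurable_half_orbit : measurable_fun setT half_orbit.
Proof. by []. Qed.

HB.instance Definition _ :=
  @isMeasurableFun.Build _ _ bool R half_orbit measurable_half_orbit.

Definition orbit_measure : probability R R :=
  distribution (@bernoulli_prob R (1 / 2)) half_orbit.

Lemma orbit_measureE (B : set R) :
  orbit_measure B =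
  ((1 / 2)%:E * \d_(1 / 3 : R)%R B + (1 / 2)%:E * \d_(2 / 3 : R)%R B)%E.
Proof.
rewrite /orbit_measure /= /distribution /pushforward bernoulli_probE;
  last by lra.
rewrite /unstable.onem (_ : 1 - 1 / 2 = 1 / 2 :> R); last by lra.
by rewrite !diracE.
Qed.

(** The map [Tdbl] swaps the two atoms, which have equal mass. *)
Lemma orbit_measure_invariant : T_invariant orbit_measure.
Proof.
split=> [|B mB]; rewrite !orbit_measureE !diracE.
  rewrite !mem_set /=; [|rewrite in_itv /=; lra..].
  by rewrite !mule1 -EFinD; congr EFin; lra.
have inE (x : R) : (x \in @Tdbl R @^-1` B) = (Tdbl x \in B).
  by apply/idP/idP => /set_mem ?; exact: mem_set.
by rewrite !inE Tdbl_third Tdbl_two_thirds addeC.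
Qed.

Lemma integral_Asin_orbit_measure :
  (\int[orbit_measure]_x (Asin x)%:E = (3 / 4)%:E)%E.
Proof.
rewrite ge0_integral_distribution //.
- rewrite integral_bernoulli_prob /=; first last.
  + by move=> b; rewrite lee_fin Asin_ge0.
  + by lra.
  rewrite Asin_third Asin_two_thirds -!EFinM -EFinD; congr EFin;
    rewrite /unstable.onem; lra.
- by apply/measurable_EFinP; exact: measurable_Asin.
- by move=> x; rewrite lee_fin Asin_ge0.
Qed.

Lemma mA_Asin : mA (@Asin R) = (3 / 4)%:E.
Proof.
apply/eqP; rewrite eq_le; apply/andP; split.
  by apply: ge_ereal_sup => _ [mu [inv ->]]; exact: integral_Asin_le.
apply: ereal_sup_ubound; exists orbit_measure.
by rewrite integral_Asin_orbit_measure; split => //;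
  exact: orbit_measure_invariant.
Qed.

End MaximalMean.

Theorem mainTheorem1 (R : realType) :
  mA (@Asin R) = (@mhat R)%:E /\ calibrated_subaction (@Asin R) (@Vfun R).
Proof.
rewrite /calibrated_subaction mA_Asin mhatE; split=> //; split.
- exact: Vfun_continuous.
- by rewrite !VfunE ?subr0 ?subrr 1?maxC //; lra.
- by move=> x; rewrite in_itv /=; exact: Vfun_calibrated.
Qed.
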